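(* Let $1\le p,q\le\infty$ with $\frac1p+\frac1q\le1$, let $X_1,\dots,X_n,Y$ be Banach spaces, let $\beta$ be a reasonable crossnorm on $X_1\otimes\dots\otimes X_n$ and let $T:X_1\times\dots\times X_n\to Y$ be a multilinear operator. The following are equivalent: (i) $T$ is $\beta$-$(p,q)$-dominated. (ii) There exists a constant $C>0$ such that for all finite dimensional subspaces $E_i$ of $X_i$, $1\le i\le n$, and all closed finite codimensional subspaces $L$ of $Y$, the operator $Q_L f_T I_{E_1,\dots,E_n}:E_1\times\dots\times E_n\to Y/L$ is $\beta|$-$(p,q)$-dominated with $D_{p,q}^{\beta|}(Q_L f_T I_{E_1,\dots,E_n})\le C$. In this situation $D_{p,q}^\beta(T)=\sup D_{p,q}^{\beta|}(Q_L f_T I_{E_1,\dots,E_n})$, where the supremum is taken over all $E_i$ and $L$ as in (ii).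
   Context: All Banach spaces are over the same field $\mathbb K\in\{\mathbb R,\mathbb C\}$; $s^*$ is the conjugate exponent of $s\in[1,\infty]$; $B_X$ is the closed unit ball. A norm $\beta$ on the algebraic tensor product $X_1\otimes\dots\otimes X_n$ is a reasonable crossnorm if $\varepsilon(u)\le\beta(u)\le\pi(u)$ for all $u$, where $\varepsilon$ and $\pi$ are the injective and projective tensor norms. If $E_i\subset X_i$ are closed subspaces, $\beta|$ denotes the restriction of $\beta$ to $E_1\otimes\dots\otimes E_n$, which is a reasonable crossnorm there. $\mathcal L^\beta(X_1,\dots,X_n)$ is the Banach space of multilinear forms $\varphi:X_1\times\dots\times X_n\to\mathbb K$ whose linearization $\widetilde\varphi:(X_1\otimes\dots\otimes X_n,\beta)\to\mathbb K$ is bounded, with norm $\|\varphi\|_\beta=\|\widetilde\varphi\|$. For finite sequences, $\|(x_i^1\otimes\dots\otimes x_i^n-z_i^1\otimes\dots\otimes z_i^n)_{i=1}^m\|_p^{w,\beta}=\sup_{\varphi\in B_{\mathcal L^\beta(X_1,\dots,X_n)}}\big(\sum_i|\varphi(x_i^1,\dots,x_i^n)-\varphi(z_i^1,\dots,z_i^n)|^p\big)^{1/p}$ and $\|(y_i^* )_{i=1}^m\|_q^w=\sup_{y^{**}\in B_{Y^{**}}}\big(\sum_i|y^{**}(y_i^* )|^q\big)^{1/q}$ (maxima over $i$ if the exponent is $\infty$). Let $r\in[1,\infty]$ be determined by $1=\frac1r+\frac1p+\frac1q$. $T$ is $\beta$-$(p,q)$-dominated if there is $C>0$ with $$\|(\langle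 y_i^*,T(x_i^1,\dots,x_i^n)-T(z_i^1,\dots,z_i^n)\rangle)_{i=1}^m\|_{r^*}\le C\,\|(x_i^1\otimes\dots\otimes x_i^n-z_i^1\otimes\dots\otimes z_i^n)_{i=1}^m\|_p^{w,\beta}\,\|(y_i^* )_{i=1}^m\|_q^w$$ for all finite sequences $(x_i^1,\dots,x_i^n)_{i=1}^m,(z_i^1,\dots,z_i^n)_{i=1}^m$ in $X_1\times\dots\times X_n$ and $(y_i^* )_{i=1}^m$ in $Y^*$; $D_{p,q}^\beta(T)$ is the infimum of such $C$. The same definition applies to operators on $E_1\times\dots\times E_n$ with the crossnorm $\beta|$. $f_T$ is the restriction to the decomposable tensors of the linearization of $T$: $f_T(x^1\otimes\dots\otimes x^n)=T(x^1,\dots,x^n)$. $I_{E_1,\dots,E_n}:E_1\times\dots\times E_n\to X_1\otimes\dots\otimes X_n$ is $(x^1,\dots,x^n)\mapsto x^1\otimes\dots\otimes x^n$, and $Q_L:Y\to Y/L$ is the quotient map; so $Q_Lf_TI_{E_1,\dots,E_n}(x^1,\dots,x^n)=Q_L(T(x^1,\dots,x^n))$. *)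

(* Defs.v *)
From HB Require Import structures.
From mathcomp Require Import all_boot all_order all_algebra.
From mathcomp Require Import generic_quotient ring_quotient.
From mathcomp Require Import complex.
From mathcomp Require Import all_classical all_reals all_analysis.

Set Implicit Arguments.
Unset Strict Implicit.
Unset Printing Implicit Defensive.

Import Order.TTheory GRing.Theory Num.Theory.
Import numFieldNormedType.Exports.

Local Open Scope classical_set_scope.
Local Open Scope ring_scope.

Variant scalar_kind := RealScalars | ComplexScalars.

Definition scalars (R : realType) (k : scalar_kind) : numFieldType :=
  match k with RealScalars => R | ComplexScalars => R[i]%C end.

(* The library norm of a normed space over a numFieldType takes its values in
   that field; over R[i] it is a real element of R[i].  [reK] and [ofR] convert
   between such elements and R, and [rnorm] is the norm as an element of R. *)
Section Scalars.
Variables (R : realType) (k : scalar_kind).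
Local Notation K := (scalars R k).

Definition reK : K -> R :=
  match k return scalars R k -> R with
  | RealScalars => fun x => x
  | ComplexScalars => fun x => complex.Re x
  end.

Definition ofR : R -> K :=
  match k return R -> scalars R k with
  | RealScalars => fun x => x
  | ComplexScalars => fun x => (x%:C)%C
  end.

Definition rnorm (V : normedZmodType K) (v : V) : R := reK `|v|.

Lemma ofRK : cancel ofR reK.
Proof. by rewrite /ofR /reK; case: k. Qed.

Lemma reKK (x : K) : x \is Num.real -> ofR (reK x) = x.
Proof. by rewrite /ofR /reK; move: x; case: k => //= x /RRe_real. Qed.

Lemma ofRD x y : ofR (x + y) = ofR x + ofR y.
Proof. by rewrite /ofR; case: k => //=; rewrite rmorphD. Qed.

Lemma ofRM x y : ofR (x * y) = ofR x * ofR y.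
Proof. by rewrite /ofR; case: k => //=; rewrite rmorphM. Qed.

Lemma ofR0 : ofR 0 = 0.
Proof. by rewrite /ofR; case: k. Qed.

Lemma ler_ofR x y : (ofR x <= ofR y) = (x <= y).
Proof. by rewrite /ofR; case: k => //=; rewrite lecR. Qed.

Lemma ofR_rnorm (V : normedZmodType K) (v : V) : ofR (rnorm v) = `|v|.
Proof. by rewrite /rnorm reKK// normr_real. Qed.

Lemma rnorm_ge0 (V : normedZmodType K) (v : V) : 0 <= rnorm v.
Proof. by rewrite -ler_ofR ofR0 ofR_rnorm normr_ge0. Qed.

Lemma ler_rnormD (V : normedZmodType K) (u v : V) :
  rnorm (u + v) <= rnorm u + rnorm v.
Proof. by rewrite -ler_ofR ofRD !ofR_rnorm ler_normD. Qed.

Lemma rnormN (V : normedZmodType K) (v : V) : rnorm (- v) = rnorm v.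
Proof. by rewrite /rnorm normrN. Qed.

Lemma rnorm0 (V : normedZmodType K) : rnorm (0 : V) = 0.
Proof. by apply: (can_inj ofRK); rewrite ofR_rnorm normr0 ofR0. Qed.

Lemma rnorm0_eq0 (V : normedZmodType K) (v : V) : rnorm v = 0 -> v = 0.
Proof. by move=> /(congr1 ofR); rewrite ofR_rnorm ofR0 => /normr0_eq0. Qed.

Lemma rnormM (a b : K) : rnorm (a * b) = rnorm a * rnorm b.
Proof. by apply: (can_inj ofRK); rewrite ofRM !ofR_rnorm normrM. Qed.

Lemma rnormZ (V : normedModType K) (a : K) (v : V) :
  rnorm (a *: v) = rnorm a * rnorm v.
Proof. by apply: (can_inj ofRK); rewrite ofRM !ofR_rnorm normrZ. Qed.

End Scalars.

Section Subspaces.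
Variables (R : realType) (k : scalar_kind).
Local Notation K := (scalars R k).
Implicit Type V : normedModType K.

Definition finite_dimensional (V : lmodType K) : Prop :=
  exists s : seq V, forall v : V,
    exists c : nat -> K, v = \sum_(i < size s) c i *: s`_i.

Record lin_subspace V := Subspace {
  subspace_set :> set V ;
  subspace0 : subspace_set 0 ;
  subspaceP : forall (a : K) (u v : V),
    subspace_set u -> subspace_set v -> subspace_set (a *: u + v)
}.

Section SubspaceNormed.
Variables (V : normedModType K) (E : lin_subspace V).

Definition in_subspace : {pred V} := fun v => `[< subspace_set E v >].

Lemma in_subspace_closed : GRing.submod_closed in_subspace.
Proof.
split; first exact/asboolP/subspace0.
by move=> a u v /asboolP uE /asboolP vE; apply/asboolP/subspaceP.
Qed.

HB.instance Definition _ :=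
  GRing.isSubmodClosed.Build K V in_subspace in_subspace_closed.

Definition subspace_type := {v : V | v \in in_subspace}.

HB.instance Definition _ := Choice.on subspace_type.
HB.instance Definition _ := SubType.on subspace_type.
HB.instance Definition _ := [SubChoice_isSubLmodule of subspace_type by <:].

Definition subspace_norm (v : subspace_type) : K := `|val v|.

Lemma subspace_normD u v :
  subspace_norm (u + v) <= subspace_norm u + subspace_norm v.
Proof. by rewrite /subspace_norm raddfD ler_normD. Qed.

Lemma subspace_normZ (a : K) v :
  subspace_norm (a *: v) = `|a| * subspace_norm v.
Proof. by rewrite /subspace_norm linearZ normrZ. Qed.

Lemma subspace_norm0 v : subspace_norm v = 0 -> v = 0.
Proof. by move=> /normr0_eq0 v0; apply: val_inj; rewrite v0 raddf0. Qed.

HB.instance Definition _ := Lmodule_isNormed.Build K subspace_type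
  subspace_normD subspace_normZ subspace_norm0.

Lemma rnorm_subspace (v : subspace_type) : rnorm v = rnorm (val v).
Proof. by []. Qed.

End SubspaceNormed.

Record closed_subspace V := ClosedSubspace {
  closed_subspace_sub :> lin_subspace V ;
  closed_subspaceP : closed closed_subspace_sub
}.

Section Quotient.
Variables (V : normedModType K) (L : closed_subspace V).
Local Open Scope quotient_scope.

Definition quot_space := Quotient.quot (in_subspace L).

HB.instance Definition _ := GRing.Zmodule.on quot_space.

Definition quot_map (v : V) : quot_space := \pi v.

Lemma quot_mapP u v : quot_map u = quot_map v <-> subspace_set L (u - v).
Proof.
split=> [/eqP|uv].
  by rewrite /quot_map -Quotient.idealrBE => /asboolP.
by apply/eqP; rewrite /quot_map -Quotient.idealrBE; exact/asboolP.
Qed.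

Lemma quot_map_surj q : exists v, quot_map v = q.
Proof. by exists (repr q); rewrite /quot_map reprK. Qed.

Lemma quot_mapD u v : quot_map (u + v) = quot_map u + quot_map v.
Proof. by rewrite /quot_map !piE. Qed.

Definition quot_scale (a : K) (q : quot_space) : quot_space :=
  quot_map (a *: repr q).

Lemma quot_scaleE a v : quot_scale a (quot_map v) = quot_map (a *: v).
Proof.
apply/quot_mapP; rewrite -scalerBr -[_ *: _]addr0.
apply: subspaceP; last exact: subspace0.
by apply/quot_mapP; rewrite /quot_map reprK.
Qed.

Lemma quot_scaleA a b q :
  quot_scale a (quot_scale b q) = quot_scale (a * b) q.
Proof.
by have [v <-] := quot_map_surj q; rewrite !quot_scaleE scalerA.
Qed.

Lemma quot_scale1 : left_id 1 quot_scale.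
Proof. by move=> q; have [v <-] := quot_map_surj q; rewrite quot_scaleE scale1r. Qed.

Lemma quot_scaleDr : right_distributive quot_scale +%R.
Proof.
move=> a q q'; have [v <-] := quot_map_surj q; have [w <-] := quot_map_surj q'.
by rewrite -quot_mapD !quot_scaleE scalerDr quot_mapD.
Qed.

Lemma quot_scaleDl q : {morph quot_scale^~ q : a b / a + b}.
Proof.
by move=> a b; have [v <-] := quot_map_surj q; rewrite !quot_scaleE scalerDl quot_mapD.
Qed.

HB.instance Definition _ := GRing.Zmodule_isLmodule.Build K quot_space
  quot_scaleA quot_scale1 quot_scaleDr quot_scaleDl.

Lemma quot_mapZ (a : K) v : quot_map (a *: v) = a *: quot_map v.
Proof. by rewrite -quot_scaleE. Qed.

Definition quot_rnorm (q : quot_space) : R :=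
  inf [set rnorm v | v in [set v | quot_map v = q]].

Lemma quot_rnorm_has_inf q :
  has_inf [set rnorm v | v in [set v | quot_map v = q]].
Proof.
split; first by have [v vq] := quot_map_surj q; exists (rnorm v), v.
by exists 0 => _ [v _ <-]; exact: rnorm_ge0.
Qed.

Lemma quot_rnorm_le v : quot_rnorm (quot_map v) <= rnorm v.
Proof. by apply: ge_inf; [case: (quot_rnorm_has_inf (quot_map v))|exists v]. Qed.

Lemma quot_rnorm_ge0 q : 0 <= quot_rnorm q.
Proof.
apply: lb_le_inf; first by case: (quot_rnorm_has_inf q).
by move=> _ [v _ <-]; exact: rnorm_ge0.
Qed.

Lemma quot_rnorm_lt q (e : R) : 0 < e ->
  exists2 v, quot_map v = q & rnorm v < quot_rnorm q + e.
Proof.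
move=> e0; have [_ [v vq <-] ve] := inf_adherent e0 (quot_rnorm_has_inf q).
by exists v.
Qed.

Lemma quot_rnormD p q : quot_rnorm (p + q) <= quot_rnorm p + quot_rnorm q.
Proof.
apply/ler_addgt0Pl => e e0; have e20 : 0 < e / 2 by rewrite divr_gt0.
have [u <- ue] := quot_rnorm_lt p e20; have [v <- ve] := quot_rnorm_lt q e20.
rewrite -quot_mapD (le_trans (quot_rnorm_le _))// (le_trans (ler_rnormD _ _))//.
by rewrite (le_trans (ltW (ltrD ue ve)))// addrACA -splitr addrC.
Qed.

Lemma quot_rnormZ_le (a : K) q : quot_rnorm (a *: q) <= rnorm a * quot_rnorm q.
Proof.
have [a0|a0] := eqVneq (rnorm a) 0.
  rewrite (rnorm0_eq0 a0) scale0r rnorm0 mul0r.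
  have <- : quot_map 0 = 0 by rewrite -[in LHS](scale0r 0) quot_mapZ scale0r.
  by rewrite (le_trans (quot_rnorm_le _))// rnorm0.
have {}a0 : 0 < rnorm a by rewrite lt_neqAle eq_sym a0 rnorm_ge0.
rewrite -ler_pdivrMl//; apply: lb_le_inf; first by case: (quot_rnorm_has_inf q).
move=> _ [v <- <-]; rewrite ler_pdivrMl// -rnormZ -quot_mapZ.
exact: quot_rnorm_le.
Qed.

Lemma quot_rnormZ (a : K) q : quot_rnorm (a *: q) = rnorm a * quot_rnorm q.
Proof.
apply/eqP; rewrite eq_le quot_rnormZ_le /=.
have [->|a0] := eqVneq a 0.
  by rewrite rnorm0 mul0r quot_rnorm_ge0.
have ra0 : 0 < rnorm a.
  rewrite lt_neqAle rnorm_ge0 andbT; apply: contra_neq a0.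
  by move=> /esym/rnorm0_eq0.
rewrite -[in leLHS](scale1r q) -(mulVf a0) -scalerA.
rewrite -ler_pdivlMl// (le_trans (quot_rnormZ_le _ _))// ler_wpM2r//.
  exact: quot_rnorm_ge0.
suff -> : rnorm a^-1 = (rnorm a)^-1 by [].
apply: (mulIf (lt0r_neq0 ra0)); rewrite -rnormM !mulVf// ?lt0r_neq0//.
by apply: (can_inj (@ofRK R k)); rewrite ofR_rnorm normr1 /ofR; case: (k).
Qed.

Lemma quot_rnorm0 q : quot_rnorm q = 0 -> q = 0.
Proof.
have [v <-] := quot_map_surj q => v0.
suff : subspace_set L v.
  move=> vL; have <- : quot_map 0 = 0.
    by rewrite -[in LHS](scale0r 0) quot_mapZ scale0r.
  by apply/quot_mapP; rewrite subr0.
apply: (@closed_subspaceP _ L) => B /nbhs_normP[e /= e0 vB].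
have er : ofR k (reK e) = e by rewrite reKK// gtr0_real.
have re0 : 0 < reK e.
  rewrite lt_neqAle -(ler_ofR k) ofR0 er (ltW e0) andbT.
  by apply: contra_ltN e0 => /eqP e00; rewrite -er -e00 ofR0.
have [w wv wlt] := quot_rnorm_lt (quot_map v) re0.
exists (v - w); split; first exact/quot_mapP.
apply: vB => /=; rewrite opprB addrC subrK -ofR_rnorm.
rewrite -er lt_neqAle ler_ofR.
move: wlt; rewrite v0 add0r => wlt; rewrite ltW// andbT.
by apply: contraTneq wlt => /(can_inj (@ofRK R k)) ->; rewrite ltxx.
Qed.

Definition quot_norm (q : quot_space) : K := ofR k (quot_rnorm q).

Lemma quot_normD p q : quot_norm (p + q) <= quot_norm p + quot_norm q.
Proof. by rewrite /quot_norm -ofRD ler_ofR quot_rnormD. Qed.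

Lemma quot_normZ (a : K) q : quot_norm (a *: q) = `|a| * quot_norm q.
Proof. by rewrite /quot_norm quot_rnormZ ofRM ofR_rnorm. Qed.

Lemma quot_norm0 q : quot_norm q = 0 -> q = 0.
Proof.
move=> q0; apply: quot_rnorm0; apply: (can_inj (@ofRK R k)).
by rewrite ofR0.
Qed.

HB.instance Definition _ := Lmodule_isNormed.Build K quot_space
  quot_normD quot_normZ quot_norm0.

Lemma rnorm_quot (q : quot_space) : rnorm q = quot_rnorm q.
Proof. exact: ofRK. Qed.

End Quotient.

End Subspaces.

Section Dual.
Variables (R : realType) (k : scalar_kind).
Local Notation K := (scalars R k).
Variable V : normedModType K.

Definition in_dual : {pred V -> K^o} :=
  fun f => `[< linear f /\ continuous f >].

Lemma in_dual_closed : GRing.submod_closed in_dual.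
Proof.
split.
  apply/asboolP; split; last exact: cst_continuous.
  by move=> a u v; rewrite /= scaler0 addr0.
move=> a f g /asboolP[lf cf] /asboolP[lg cg]; apply/asboolP; split.
  move=> b u v; rewrite !fctE lf lg !scalerDr !scalerA addrACA.
  by rewrite [a * b]mulrC.
by move=> x; apply: cvgD; [apply: cvgZr; exact: cf|exact: cg].
Qed.

HB.instance Definition _ :=
  GRing.isSubmodClosed.Build K (V -> K^o) in_dual in_dual_closed.

Definition dual := {f : V -> K^o | f \in in_dual}.

HB.instance Definition _ := Choice.on dual.
HB.instance Definition _ := SubType.on dual.
HB.instance Definition _ := [SubChoice_isSubLmodule of dual by <:].

Definition dual_fun (f : dual) : V -> K := val f.

Lemma dual_linear (f : dual) (a : K) u v :
  dual_fun f (a *: u + v) = a * dual_fun f u + dual_fun f v.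
Proof. by have /asboolP[lf _] := valP f; exact: lf. Qed.

Lemma dual_continuous (f : dual) : continuous (dual_fun f : V -> K^o).
Proof. by have /asboolP[] := valP f. Qed.

Lemma dual_bounded (f : dual) :
  exists2 C : R, 0 <= C & forall v, rnorm (dual_fun f v) <= C * rnorm v.
Proof.
have /asboolP[lf cf] := valP f.
pose g : {linear V -> K^o} := HB.pack (val f : V -> K^o)
  (GRing.isLinear.Build K V K^o _ (val f) lf).
have /linear_boundedP/pinfty_ex_gt0[C C0 gC] :
  bounded_near g (nbhs (0 : V)) by apply: continuous_linear_bounded; exact: cf.
have Cr : ofR k (reK C) = C by rewrite reKK// gtr0_real.
exists (reK C); first by rewrite -(ler_ofR k) ofR0 Cr ltW.
by move=> v; rewrite -(ler_ofR k) ofRM Cr !ofR_rnorm; exact: gC.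
Qed.

Definition dual_rnorm (f : dual) : R :=
  sup [set rnorm (dual_fun f v) | v in [set v | rnorm v <= 1]].

Lemma dual_rnorm_has_sup f :
  has_sup [set rnorm (dual_fun f v) | v in [set v | rnorm v <= 1]].
Proof.
split; first by exists (rnorm (dual_fun f 0)), 0 => //=; rewrite rnorm0.
have [C C0 fC] := dual_bounded f; exists C => _ [v /= v1 <-].
by rewrite (le_trans (fC v))// ler_piMr.
Qed.

Lemma dual_rnorm_ge0 f : 0 <= dual_rnorm f.
Proof.
rewrite (le_trans (rnorm_ge0 (dual_fun f 0)))//.
apply: ub_le_sup; first by case: (dual_rnorm_has_sup f).
by exists 0 => //=; rewrite rnorm0.
Qed.

Lemma rnorm_ofR (x : R) : 0 <= x -> rnorm (ofR k x) = x.
Proof.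
move=> x0; apply: (can_inj (@ofRK R k)); rewrite ofR_rnorm ger0_norm//.
by rewrite -(ofR0 R k) ler_ofR.
Qed.

Lemma dual_rnormP f v : rnorm (dual_fun f v) <= dual_rnorm f * rnorm v.
Proof.
have [v0|v0] := eqVneq v 0.
  have [C _ /(_ v)] := dual_bounded f.
  by rewrite v0 rnorm0 !mulr0.
have rv0 : 0 < rnorm v.
  rewrite lt_neqAle rnorm_ge0 andbT; apply: contra_neq v0.
  by move=> /esym/rnorm0_eq0.
rewrite -ler_pdivrMr// mulrC -(@rnorm_ofR (rnorm v)^-1) ?invr_ge0 ?rnorm_ge0//.
rewrite -rnormM.
have -> a : a * dual_fun f v = dual_fun f (a *: v).
  have f0 : dual_fun f 0 = 0.
    have := dual_linear f (-1) v v.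
    by rewrite scaleN1r addNr mulN1r addNr.
  by have := dual_linear f a v 0; rewrite f0 !addr0 => ->.
apply: ub_le_sup; first by case: (dual_rnorm_has_sup f).
exists (ofR k (rnorm v)^-1 *: v) => //=.
by rewrite rnormZ rnorm_ofR ?invr_ge0 ?rnorm_ge0// mulVf ?gt_eqF.
Qed.

Lemma dual_rnorm_le f (C : R) :
  (forall v, rnorm v <= 1 -> rnorm (dual_fun f v) <= C) -> dual_rnorm f <= C.
Proof.
move=> fC; apply: ge_sup; first by case: (dual_rnorm_has_sup f).
by move=> _ [v /= v1 <-]; exact: fC.
Qed.

Definition dual_norm (f : dual) : K := ofR k (dual_rnorm f).

Lemma dual_normD f g : dual_norm (f + g) <= dual_norm f + dual_norm g.
Proof.
rewrite /dual_norm -ofRD ler_ofR; apply: dual_rnorm_le => v v1.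
have -> : dual_fun (f + g) v = dual_fun f v + dual_fun g v.
  by rewrite /dual_fun raddfD.
rewrite (le_trans (ler_rnormD _ _))// lerD//; apply: ub_le_sup.
- by case: (dual_rnorm_has_sup f).
- by exists v.
- by case: (dual_rnorm_has_sup g).
- by exists v.
Qed.

Lemma dual_normZ (a : K) f : dual_norm (a *: f) = `|a| * dual_norm f.
Proof.
rewrite /dual_norm -ofR_rnorm -ofRM; congr ofR.
have aE v : dual_fun (a *: f) v = a * dual_fun f v.
  by rewrite /dual_fun linearZ.
have [ra|a0] := eqVneq (rnorm a) 0.
  rewrite ra mul0r; apply/eqP; rewrite eq_le dual_rnorm_ge0 andbT.
  by apply: dual_rnorm_le => v v1; rewrite aE rnormM ra mul0r.
have ra0 : 0 < rnorm a by rewrite lt_neqAle eq_sym a0 rnorm_ge0.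
apply/eqP; rewrite eq_le; apply/andP; split.
  apply: dual_rnorm_le => v v1; rewrite aE rnormM ler_wpM2l// ?rnorm_ge0//.
  rewrite (le_trans (dual_rnormP f v))// ler_piMr// dual_rnorm_ge0//.
rewrite -ler_pdivlMl//; apply: dual_rnorm_le => v v1.
rewrite ler_pdivlMl// -rnormM -aE (le_trans (dual_rnormP _ v))//.
by rewrite ler_piMr// dual_rnorm_ge0.
Qed.

Lemma dual_norm0 f : dual_norm f = 0 -> f = 0.
Proof.
move=> f0; have {}f0 : dual_rnorm f = 0.
  by apply: (can_inj (@ofRK R k)); rewrite ofR0.
apply: val_inj; rewrite raddf0; apply/funext => v.
apply: rnorm0_eq0; apply/eqP; rewrite eq_le rnorm_ge0 andbT.
by rewrite (le_trans (dual_rnormP f v))// f0 mul0r.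
Qed.

HB.instance Definition _ := Lmodule_isNormed.Build K dual
  dual_normD dual_normZ dual_norm0.

Lemma rnorm_dual (f : dual) : rnorm f = dual_rnorm f.
Proof. exact: ofRK. Qed.

End Dual.

Section Tensor.
Variables (R : realType) (k : scalar_kind).
Local Notation K := (scalars R k).
Variable n : nat.
Implicit Type V : 'I_n -> normedModType K.

(* [dfwith x i u] is x with its i-th coordinate replaced by u. *)
Definition multilinear V (W : lmodType K) (T : (forall i, V i) -> W) : Prop :=
  forall (x : forall i, V i) (i : 'I_n) (a : K) (u v : V i),
    T (dfwith x i (a *: u + v)) = a *: T (dfwith x i u) + T (dfwith x i v).

Record mform V := MForm {
  form_fun :> (forall i, V i) -> K ;
  formP : multilinear (form_fun : (forall i, V i) -> K^o)
}.

Section TensorSpace.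
Variable V : 'I_n -> normedModType K.

(* The algebraic tensor product V_1 (x) ... (x) V_n, realised as the linear
   span, in the space of all functions mform V -> K, of the evaluations at
   points x of V_1 x ... x V_n; x_1 (x) ... (x) x_n is the evaluation at x.
   Since the multilinear forms separate the points of the tensor product, this
   space has its universal property.  In particular u |-> u phi is the
   linearization of the form phi. *)
Definition evaluation (x : forall i, V i) : mform V -> K^o := fun phi => phi x.

Definition in_tensor : {pred mform V -> K^o} := fun u =>
  `[< exists s : seq (K * forall i, V i),
        u = \sum_(t <- s) t.1 *: evaluation t.2 >].

Lemma in_tensor_closed : GRing.submod_closed in_tensor.
Proof.
split; first by apply/asboolP; exists [::]; rewrite big_nil.
move=> a u v /asboolP[s ->] /asboolP[s' ->]; apply/asboolP.
exists ([seq (a * t.1, t.2) | t <- s] ++ s').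
rewrite big_cat big_map scaler_sumr; congr (_ + _).
by apply: eq_bigr => t _; rewrite scalerA.
Qed.

HB.instance Definition _ :=
  GRing.isSubmodClosed.Build K (mform V -> K^o) in_tensor in_tensor_closed.

Definition tensor := {u : mform V -> K^o | u \in in_tensor}.

HB.instance Definition _ := Choice.on tensor.
HB.instance Definition _ := SubType.on tensor.
HB.instance Definition _ := [SubChoice_isSubLmodule of tensor by <:].

Lemma in_tensor_evaluation x : evaluation x \in in_tensor.
Proof.
by apply/asboolP; exists [:: (1, x)]; rewrite big_seq1 scale1r.
Qed.

Definition tens (x : forall i, V i) : tensor :=
  exist (fun u => u \in in_tensor) (evaluation x) (in_tensor_evaluation x).

Definition linearization (phi : mform V) (u : tensor) : K := val u phi.

Lemma prod_form_multilinear (f : forall i, dual (V i)) :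
  multilinear ((fun x => \prod_i dual_fun (f i) (x i)) : (forall i, V i) -> K^o).
Proof.
move=> x i a u v.
have prodE (w : V i) : \prod_j dual_fun (f j) (dfwith x i w j) =
    dual_fun (f i) w * \prod_(j < n | j != i) dual_fun (f j) (x j).
  rewrite (bigD1 i)//= dfwithin; congr (_ * _).
  by apply: eq_bigr => j ji; rewrite dfwithout// eq_sym.
by rewrite !prodE dual_linear mulrDl -mulrA.
Qed.

Definition prod_form (f : forall i, dual (V i)) : mform V :=
  MForm (prod_form_multilinear f).

Definition injective_norm (u : tensor) : \bar R :=
  ereal_sup [set (rnorm (linearization (prod_form f) u))%:E
            | f in [set f : forall i, dual (V i) | forall i, rnorm (f i) <= 1]].

Definition projective_norm (u : tensor) : \bar R :=
  ereal_inf [set (\sum_(t <- s) rnorm t.1 * \prod_i rnorm (t.2 i))%:E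
            | s in [set s : seq (K * forall i, V i) |
                     u = \sum_(t <- s) t.1 *: tens t.2]].

Record is_norm (beta : tensor -> R) : Prop := {
  is_normD : forall u v, beta (u + v) <= beta u + beta v ;
  is_normZ : forall (a : K) u, beta (a *: u) = rnorm a * beta u ;
  is_norm0 : forall u, beta u = 0 -> u = 0
}.

Definition reasonable_crossnorm (beta : tensor -> R) : Prop :=
  is_norm beta /\
  forall u, (injective_norm u <= (beta u)%:E <= projective_norm u)%E.

Definition form_norm (beta : tensor -> R) (phi : mform V) : \bar R :=
  ereal_sup [set (rnorm (linearization phi u))%:E | u in [set u | beta u <= 1]].

End TensorSpace.

Section TensorSubspace.
Variables (V : 'I_n -> normedModType K) (E : forall i, lin_subspace (V i)).
Local Notation VE := (fun i => subspace_type (E i) : normedModType K).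

Definition subspace_incl (x : forall i, VE i) : forall i, V i :=
  fun i => val (x i).

Lemma subspace_incl_dfwith (x : forall i, VE i) i (u : VE i) :
  subspace_incl (dfwith x i u) = dfwith (subspace_incl x) i (val u).
Proof.
apply: functional_extensionality_dep => j; rewrite /subspace_incl.
by case: (dfwithP x u) => [|l il]; rewrite ?dfwithin ?dfwithout.
Qed.

Lemma form_restr_multilinear (phi : mform V) :
  multilinear ((fun x => phi (subspace_incl x)) : (forall i, VE i) -> K^o).
Proof.
move=> x i a u v; rewrite !subspace_incl_dfwith linearP.
exact: formP.
Qed.

Definition form_restr (phi : mform V) : mform VE :=
  MForm (form_restr_multilinear phi).

Lemma tensor_incl_subproof (u : tensor VE) :
  (fun phi => linearization (form_restr phi) u) \in @in_tensor V.
Proof.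
have /asboolP[s us] := valP u; apply/asboolP.
exists [seq (t.1, subspace_incl t.2) | t <- s].
apply/funext => phi; rewrite /linearization us big_map !fct_sumE.
exact: eq_bigr.
Qed.

(* The canonical map E_1 (x) ... (x) E_n -> V_1 (x) ... (x) V_n. *)
Definition tensor_incl (u : tensor VE) : tensor V :=
  exist (fun v => v \in @in_tensor V) _ (tensor_incl_subproof u).

Lemma tensor_incl_tens (x : forall i, VE i) :
  tensor_incl (tens x) = tens (subspace_incl x).
Proof. exact: val_inj. Qed.

Definition restr_norm (beta : tensor V -> R) : tensor VE -> R :=
  fun u => beta (tensor_incl u).

End TensorSubspace.

End Tensor.

Section Dominated.
Variables (R : realType) (k : scalar_kind).
Local Notation K := (scalars R k).

Definition lp_norm (p : \bar R) m (a : 'I_m -> K) : R :=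
  match p with
  | r%:E => (\sum_j rnorm (a j) `^ r) `^ r^-1
  | +oo%E => \big[Num.max/0]_j rnorm (a j)
  | -oo%E => 0
  end.

Definition weak_norm (q : \bar R) (W : normedModType K) m
    (y : 'I_m -> dual W) : \bar R :=
  ereal_sup [set (lp_norm q (fun j => dual_fun psi (y j)))%:E
            | psi in [set psi : dual (dual W) | rnorm psi <= 1]].

(* r with 1 = 1/r + 1/p + 1/q; for extended reals 0^-1 = +oo and +oo^-1 = 0. *)
Definition third_exponent (p q : \bar R) : \bar R := ((1 - p^-1 - q^-1)^-1)%E.

Lemma inve_ge1 (p : \bar R) : (1 <= p)%E ->
  exists2 s : R, 0 <= s <= 1 & (p^-1 = s%:E)%E.
Proof.
case: p => [p| |]//; last by exists 0; rewrite ?lexx ?ler01 ?invey.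
rewrite lee_fin => p1; have p0 : 0 < p by rewrite (lt_le_trans ltr01).
exists p^-1; first by rewrite invr_ge0 ltW//= invf_le1.
by rewrite inver gt_eqF.
Qed.

Lemma third_exponentP (p q : \bar R) (r := third_exponent p q) :
  (1 <= p -> 1 <= q -> p^-1 + q^-1 <= 1 ->
   1 <= r /\ 1 = r^-1 + p^-1 + q^-1)%E.
Proof.
move=> /inve_ge1[a /andP[a0 a1] pa] /inve_ge1[b /andP[b0 b1] qb].
rewrite /r /third_exponent inveK pa qb -!EFinD lee_fin => ab.
split; last by congr EFin; rewrite addrAC !subrK.
have ab0 : 0 <= 1 - a - b by rewrite -addrA -opprD subr_ge0.
rewrite inver; case: ifPn => [_|ab1]; first exact: leey.
have ab_gt0 : 0 < 1 - a - b by rewrite lt_neqAle eq_sym ab1.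
rewrite lee_fin invf_ge1// -addrA -opprD gerBl addr_ge0//.
Qed.

Variable n : nat.
Variables (V : 'I_n -> normedModType K) (W : normedModType K).

Definition weak_beta_norm (p : \bar R) (beta : tensor V -> R) m
    (x z : 'I_m -> forall i, V i) : \bar R :=
  ereal_sup [set (lp_norm p (fun j => phi (x j) - phi (z j)))%:E
            | phi in [set phi : mform V | (form_norm beta phi <= 1)%E]].

Definition dominated_with (p q : \bar R) (beta : tensor V -> R)
    (T : (forall i, V i) -> W) (C : R) : Prop :=
  forall m (x z : 'I_m -> forall i, V i) (y : 'I_m -> dual W),
    ((lp_norm (hoelder_conjugate (third_exponent p q))
        (fun j => dual_fun (y j) (T (x j) - T (z j))))%:E
     <= C%:E * weak_beta_norm p beta x z * weak_norm q y)%E.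

Definition dominated (p q : \bar R) beta T : Prop :=
  exists2 C : R, 0 < C & dominated_with p q beta T C.

Definition dominated_norm (p q : \bar R) beta T : \bar R :=
  ereal_inf [set C%:E | C in [set C : R | 0 < C /\ dominated_with p q beta T C]].

End Dominated.

Section Reduction.
Variables (R : realType) (k : scalar_kind).
Local Notation K := (scalars R k).
Variable n : nat.
Variables (V : 'I_n -> normedModType K) (W : normedModType K).

(* Q_L f_T I_{E_1,...,E_n}, where f_T maps x_1 (x) ... (x) x_n to T (x_1, ..., x_n). *)
Definition reduction (T : (forall i, V i) -> W) (E : forall i, lin_subspace (V i))
    (L : closed_subspace W) : (forall i, subspace_type (E i)) -> quot_space L :=
  fun x => quot_map L (T (subspace_incl x)).

End Reduction.

(* Main.v *)
(* Given finitely many points of X_1 x ... x X_n and functionals on Y, let E_i be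
   spanned by the i-th coordinates of the points and let L be the common kernel
   of the functionals; these then factor through Y/L.  Both E_i and Y/L are
   finite dimensional, and the domination inequality of T at these data is the
   domination inequality of Q_L f_T I_E: by Hahn-Banach for the norm beta, every
   form on the E_i extends to one on the X_i with the same beta-norm, and since
   the adjoint of Q_L is an isometric embedding of (Y/L)^* into Y^*, every
   functional on (Y/L)^* extends to one on Y^* with the same norm. *)
From HB Require Import structures.
Require Import Defs.
From mathcomp Require Import all_boot all_order all_algebra.
From mathcomp Require Import complex ring lra.
From mathcomp Require Import all_classical all_reals all_analysis.

Set Implicit Arguments.
Unset Strict Implicit.
Unset Printing Implicit Defensive.

Import Order.TTheory GRing.Theory Num.Theory.
Import numFieldNormedType.Exports.

Local Open Scope classical_set_scope.
Local Open Scope ring_scope.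

(** * Hahn-Banach over the reals and the complexes *)

Section ScalarsExtra.
Variables (R : realType) (k : scalar_kind).
Local Notation K := (scalars R k).

Lemma ofR1 : ofR k (1 : R) = 1.
Proof. by rewrite /ofR; case: k. Qed.

Lemma ofRN (x : R) : ofR k (- x) = - ofR k x.
Proof. by apply/eqP; rewrite -addr_eq0 -ofRD addNr ofR0. Qed.

Lemma reKD (a b : K) : reK (a + b) = reK a + reK b.
Proof. by rewrite /reK; move: a b; case: k => //= a b; rewrite raddfD. Qed.

Lemma reK_ofRM (r : R) (a : K) : reK (ofR k r * a) = r * reK a.
Proof.
rewrite /reK /ofR; move: a; case: k => //= -[x y] /=.
by rewrite mul0r subr0.
Qed.

Lemma reK_le (a : K) : reK a <= rnorm a.
Proof.
rewrite /rnorm /reK; move: a; case: k => /= a; first exact: ler_norm.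
apply: (@le_trans _ _ (complex.Re (`|a : R[i]|)%C)); last exact: lexx.
rewrite normc_def /=; apply: le_trans (ler_norm _) _.
by rewrite -sqrtr_sqr ler_wsqrtr// lerDl sqr_ge0.
Qed.

Lemma rnorm1 : rnorm (1 : K) = 1.
Proof. by rewrite -ofR1 rnorm_ofR ?ler01. Qed.

End ScalarsExtra.

Section HahnBanachReal.
Variables (R : realType) (k : scalar_kind).
Local Notation K := (scalars R k).
Variables (V : lmodType K) (p : V -> R).
Hypothesis pD : forall u v, p (u + v) <= p u + p v.
Hypothesis pZ : forall (r : R) u, 0 <= r -> p (ofR k r *: u) = r * p u.

(** A partially defined real-linear functional is encoded by its graph, so that no domain has to be
    carried along. Single-valuedness is not imposed: it follows from linearity and the bound by
    [p]. *)
Definition dominated_graph (G : set (V * R)) :=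
  [/\ G (0, 0),
      forall r u a v b, G (u, a) -> G (v, b) -> G (ofR k r *: u + v, r * a + b) &
      forall u a, G (u, a) -> a <= p u].

(** Each [(u, a)] in [G] forces the value [c] at [v0] to satisfy
    [a - p (u - v0) <= c <= p (u + v0) - a]; the supremum of the lower bounds meets all these
    constraints. *)
Lemma dominated_graph_extend (G : set (V * R)) v0 : dominated_graph G ->
  exists G', [/\ dominated_graph G', G `<=` G' & exists c, G' (v0, c)].
Proof.
case=> G0 Glin Gp.
pose S := [set e.2 - p (e.1 - v0) | e in G].
(* Lower bounds stay below upper bounds, since [b + a <= p (w + u) <= p (w - v0) + p (u + v0)]. *)
have Sle u a : G (u, a) -> ubound S (p (u + v0) - a).
  move=> Gu _ [[w b] Gw <-] /=; rewrite lerBlDr addrAC lerBrDr.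
  have := Gp _ _ (Glin 1 _ _ _ _ Gw Gu); rewrite ofR1 scale1r mul1r => /le_trans.
  apply; have -> : w + u = (w - v0) + (u + v0) by rewrite addrACA addNr addr0.
  by rewrite (le_trans (pD _ _))// addrC.
have supS : has_sup S.
  split; first by exists (0 - p (0 - v0)), (0, 0).
  by exists (p (0 + v0) - 0); exact: Sle.
pose c := sup S.
have c_le u a : G (u, a) -> c <= p (u + v0) - a.
  by move=> /Sle; apply: ge_sup; case: supS.
have c_ge u a : G (u, a) -> a - p (u - v0) <= c.
  by move=> Gu; apply: ub_le_sup; [case: supS|exists (u, a)].
pose G' := [set e | exists t, exists2 f, G f &
  e = (f.1 + ofR k t *: v0, f.2 + t * c)].
exists G'; split.
- split.
  + by exists 0, (0, 0) => //=; rewrite ofR0 scale0r mul0r !addr0.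
  + move=> r _ _ _ _ [t [[u a] Gu [-> ->]]] [s [[v b] Gv [-> ->]]].
    exists (r * t + s), (ofR k r *: u + v, r * a + b); first exact: Glin.
    congr pair => /=; last by ring.
    by rewrite ofRD ofRM scalerDl [in LHS]scalerDr scalerA addrACA.
  + move=> _ _ [t [[u a] Gu [-> ->]]] /=.
    have scaleG s : G (ofR k s *: u, s * a).
      by have := Glin s _ _ _ _ Gu G0; rewrite !addr0.
    (* For nonzero [t], scaling by [1/|t|] reduces the bound to [c_le] when [t] is positive and to
       [c_ge] when it is negative. *)
    have [t0|t0|->] := ltgtP t 0; last first.
    * by rewrite ofR0 scale0r mul0r !addr0; exact: Gp.
    * have := c_le _ _ (scaleG t^-1); rewrite -(ler_pM2l t0) mulrBr.
      rewrite -(pZ _ (ltW t0)) scalerDr scalerA -ofRM divff ?gt_eqF// ofR1 scale1r.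
      by rewrite mulrA divff ?gt_eqF// mul1r; lra.
    * have s0 : 0 < - t by rewrite oppr_gt0.
      have := c_ge _ _ (scaleG (- t)^-1); rewrite -(ler_pM2l s0) mulrBr.
      rewrite -(pZ _ (ltW s0)) scalerBr scalerA -ofRM divff ?gt_eqF// ofR1 scale1r.
      by rewrite mulrA divff ?gt_eqF// mul1r ofRN scaleNr opprK; lra.
- by move=> e Ge; exists 0, e => //; rewrite ofR0 scale0r mul0r !addr0; case: e {Ge}.
- by exists c, 1, (0, 0) => //=; rewrite ofR1 scale1r mul1r !add0r.
Qed.

(** By Zorn's lemma there is a maximal dominated graph containing [G0]; it is defined everywhere, as
    the one-step extension would otherwise enlarge it. *)
Lemma dominated_graph_total (G0 : set (V * R)) : dominated_graph G0 ->
  exists2 G, dominated_graph G & G0 `<=` G /\ forall v, exists c, G (v, c).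
Proof.
move=> dG0.
(* Zorn_bigcup also unites the empty chain, hence the union with G0. *)
have [F FP Ftot|G [dG Gmax]] := @Zorn_bigcup _ [set G | dominated_graph (G0 `|` G)].
  (* Each clause of [dominated_graph] involves at most two given members of the graph, and two
     members of the union lie together in [G0] or in the union of [G0] with a single element of the
     chain. *)
  have chain e f : (G0 `|` \bigcup_(X in F) X) e -> (G0 `|` \bigcup_(X in F) X) f ->
      exists2 H, dominated_graph H &
        [/\ H `<=` G0 `|` \bigcup_(X in F) X, H e & H f].
    have inF X : F X -> G0 `|` X `<=` G0 `|` \bigcup_(X in F) X.
      by move=> FX; apply: setUS; exact: bigcup_sup.
    move=> [e0|[X FX Xe]] [f0|[X' FX' Xf]].
    - by exists G0 => //; split => //; exact: subsetUl.
    - by exists (G0 `|` X'); [exact: FP|split; [exact: inF|left|right]].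
    - by exists (G0 `|` X); [exact: FP|split; [exact: inF|right|left]].
    - have [XX'|XX'] := Ftot _ _ FX FX'.
        by exists (G0 `|` X'); [exact: FP|split; [exact: inF|right; exact: XX'|right]].
      by exists (G0 `|` X); [exact: FP|split; [exact: inF|right|right; exact: XX']].
  split.
  - by left; case: dG0.
  - move=> r u a v b Gu Gv; have [H [_ Hlin _] [HG Hu Hv]] := chain _ _ Gu Gv.
    by apply: HG; exact: Hlin.
  - by move=> u a Gu; have [H [_ _ Hp] [_ Hu _]] := chain _ _ Gu Gu; exact: Hp.
exists (G0 `|` G) => //; split; first exact: subsetUl.
move=> v; have [G' [dG' GG' [c cG']]] := dominated_graph_extend v dG.
exists c; apply: contrapT => nc; apply: (Gmax G') => //=; last first.
  suff -> : G0 `|` G' = G' by [].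
  by apply/setUidPr; apply: subset_trans GG'; exact: subsetUl.
split; first by move=> e Ge; apply: GG'; right.
by move=> /(_ _ cG') Gc; apply: nc; right.
Qed.

Lemma hahn_banach_real (G0 : set (V * R)) : dominated_graph G0 ->
  exists g : V -> R, [/\ forall r u v, g (ofR k r *: u + v) = r * g u + g v,
    forall v, g v <= p v & forall v a, G0 (v, a) -> g v = a].
Proof.
move=> /dominated_graph_total[G [G00 Glin Gp] [G0G Gtot]].
have p0 : p 0 = 0 by rewrite -(scale0r 0) -[X in X *: _](@ofR0 R k) pZ// mul0r.
(* Subtracting two values at [v] gives a pair over 0, whose second entry is at most [p 0 = 0];
   exchanging the two values gives equality. *)
have Gfun v a b : G (v, a) -> G (v, b) -> a = b.
  have le c d : G (v, c) -> G (v, d) -> d <= c.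
    move=> Gc Gd; have := Gp _ _ (Glin (-1) _ _ _ _ Gc Gd).
    by rewrite ofRN ofR1 scaleN1r addNr p0 mulN1r addrC subr_le0.
  by move=> Ga Gb; apply/eqP; rewrite eq_le !le.
pose g v := sval (cid (Gtot v)); have gG v : G (v, g v) := svalP (cid (Gtot v)).
exists g; split=> [r u v|v|v a /G0G Gv].
- by apply: Gfun; [exact: gG|exact: Glin].
- exact: Gp.
- exact: Gfun (gG v) Gv.
Qed.

End HahnBanachReal.

Section HahnBanach.
Variables (R : realType) (k : scalar_kind).
Local Notation K := (scalars R k).

(** For complex scalars [h v = g v - i g (i v)], the only complex-linear functional with real part
    [g]; for real scalars [h] is [g] itself. *)
Lemma real_part_of_linear (V : lmodType K) (g : V -> R) :
  (forall r u v, g (ofR k r *: u + v) = r * g u + g v) ->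
  exists2 h : V -> K, (forall a u v, h (a *: u + v) = a * h u + h v) &
    forall v, reK (h v) = g v.
Proof.
move: V g; case: k => V g glin; first by exists g.
exists (fun v => ((g v) +i* (- g ('i%C *: v)))%C : R[i]) => //.
have g0 : g 0 = 0 by have := glin (-1) 0 0; rewrite scaler0 addr0 => ->; lra.
have gD u v : g (u + v) = g u + g v.
  by have := glin 1 u v; rewrite scale1r mul1r.
have gZ r u : g ((r%:C)%C *: u) = r * g u.
  by have := glin r u 0; rewrite g0 !addr0.
have gC (x y : R) u : g ((x +i* y)%C *: u) = x * g u + y * g ('i%C *: u).
  rewrite -!gZ -gD scalerA -scalerDl; congr (g (_ *: u)).
  apply/eqP; rewrite eq_complex /=.
  by rewrite !mulr0 !mul0r mulr1 subr0 !addr0 add0r !eqxx.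
move=> [x y] u v; rewrite scalerDr !gD gC.
have -> : g ('i%C *: ((x +i* y)%C *: u)) = - y * g u + x * g ('i%C *: u).
  rewrite -gC scalerA; congr (g (_ *: u)).
  by apply/eqP; rewrite eq_complex /= !mul0r !mul1r !add0r !eqxx.
apply/eqP; rewrite eq_complex /=.
by apply/andP; split; apply/eqP; ring.
Qed.

(** If [d = f u - g u] were nonzero, then [f] and [g] would differ by exactly 1 at [d^-1 *: u], and
    so would their real parts. *)
Lemma linear_reK_inj (U : lmodType K) (f g : U -> K) :
  (forall a u v, f (a *: u + v) = a * f u + f v) ->
  (forall a u v, g (a *: u + v) = a * g u + g v) ->
  (forall u, reK (f u) = reK (g u)) -> f =1 g.
Proof.
move=> flin glin fg u.
have lin0 h : (forall a u v, h (a *: u + v) = a * h u + h v) -> h (0 : U) = 0 :> K.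
  by move=> /(_ (-1) 0 0); rewrite scaler0 addr0 mulN1r addNr.
have linZ h : (forall a u v, h (a *: u + v) = a * h u + h v) ->
    forall a (v : U), h (a *: v) = a * h v :> K.
  by move=> hlin a v; have := hlin a v 0; rewrite (lin0 _ hlin) !addr0.
apply/eqP; rewrite -subr_eq0; apply/negPn/negP => d0.
have := fg ((f u - g u)^-1 *: u); rewrite !linZ//.
move=> /eqP; rewrite -subr_eq0 => /eqP re0.
suff : reK (1 : K) = 0 by rewrite -ofR1 ofRK => /eqP; rewrite oner_eq0.
rewrite -(mulVf d0) mulrBr reKD.
by rewrite -mulN1r -(@ofR1 R k) -ofRN reK_ofRM mulN1r.
Qed.

(** The subspace is given as the range of a linear map [j], which suits [tensor_incl] and
    [quot_adjoint], whose domains are types of their own. The bound by [p (j u)] makes [f u] depend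
    on [j u] only. *)
Theorem hahn_banach (U V : lmodType K) (j : U -> V) (p : V -> R) (f : U -> K) :
  (forall u v, p (u + v) <= p u + p v) ->
  (forall (a : K) u, p (a *: u) = rnorm a * p u) ->
  (forall a u v, j (a *: u + v) = a *: j u + j v) ->
  (forall a u v, f (a *: u + v) = a * f u + f v) ->
  (forall u, rnorm (f u) <= p (j u)) ->
  exists g : V -> K, [/\ forall a u v, g (a *: u + v) = a * g u + g v,
    forall v, rnorm (g v) <= p v & forall u, g (j u) = f u].
Proof.
move=> pD pZ jlin flin fp.
have j0 : j 0 = 0 by have := jlin (-1) 0 0; rewrite scaler0 addr0 scaleN1r addNr.
have f0 : f 0 = 0 by have := flin (-1) 0 0; rewrite scaler0 addr0 mulN1r addNr.
have pZr (r : R) u : 0 <= r -> p (ofR k r *: u) = r * p u.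
  by move=> r0; rewrite pZ rnorm_ofR.
pose G0 := [set e | exists u, e = (j u, reK (f u))].
have dG0 : dominated_graph p G0.
  split.
  - by exists 0; rewrite j0 f0 -(ofR0 R k) ofRK.
  - move=> r _ _ _ _ [u [-> ->]] [v [-> ->]].
    by exists (ofR k r *: u + v); rewrite jlin flin reKD reK_ofRM.
  - by move=> _ _ [u [-> ->]]; exact: le_trans (reK_le _) (fp u).
have [g [glin gp gG0]] := hahn_banach_real pD pZr dG0.
have [h hlin hg] := real_part_of_linear glin.
have h0 : h 0 = 0 by have := hlin (-1) 0 0; rewrite scaler0 addr0 mulN1r addNr.
exists h; split => // [v|].
- have [hv0|hv0] := eqVneq (h v) 0.
    (* Where [h] vanishes the claim is [0 <= p v], obtained from subadditivity, [p 0 = 0] and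
       [p (- v) = p v]. *)
    have : 0 <= p v + p (- v).
      rewrite (le_trans _ (pD _ _))// subrr.
      by have := pZ 0 0; rewrite scaler0 rnorm0 mul0r => ->.
    by rewrite -scaleN1r pZ rnormN rnorm1 mul1r hv0 rnorm0; lra.
  (* Rotating v makes h v real and positive without changing p v. *)
  pose a := `|h v| / h v.
  have na : rnorm a = 1.
    by rewrite /rnorm normrM normfV normr_id divff ?normr_eq0// -ofR1 ofRK.
  have -> : rnorm (h v) = g (a *: v).
    rewrite -hg; have := hlin a v 0; rewrite h0 !addr0 => ->.
    by rewrite /a mulfVK.
  by rewrite (le_trans (gp _))// pZ na mul1r.
- apply: linear_reK_inj => // [a u v|u]; first by rewrite jlin hlin.
  by rewrite hg; apply: gG0; exists u.
Qed.

End HahnBanach.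

(** * Duals of quotients *)

Section Functionals.
Variables (R : realType) (k : scalar_kind).
Local Notation K := (scalars R k).

Lemma dual_of_bounded (V : normedModType K) (f : V -> K) (C : R) :
  (forall a u v, f (a *: u + v) = a * f u + f v) -> 0 <= C ->
  (forall v, rnorm (f v) <= C * rnorm v) ->
  exists2 d : dual V, dual_fun d = f & rnorm d <= C.
Proof.
move=> flin C0 fC.
have fd : (f : V -> K^o) \in @in_dual R k V.
  apply/asboolP; split=> //.
  pose g : {linear V -> K^o} := HB.pack (f : V -> K^o)
    (GRing.isLinear.Build K V K^o _ (f : V -> K^o) flin).
  suff : continuous g by [].
  apply: bounded_linear_continuous; apply/linear_boundedP.
  near=> M => v; rewrite -[leLHS]ofR_rnorm.
  apply: (@le_trans _ _ (ofR k C * `|v|)).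
    by rewrite -ofR_rnorm -ofRM ler_ofR fC.
  rewrite ler_wpM2r//; near: M; apply: nbhs_pinfty_ge.
  by rewrite -[ofR k C]ger0_norm ?normr_real// -(ofR0 R k) ler_ofR.
exists (exist (fun g => g \in @in_dual R k V) (f : V -> K^o) fd) => //.
rewrite rnorm_dual; apply: dual_rnorm_le => v v1.
by rewrite (le_trans (fC v))// ler_piMr.
Unshelve. all: end_near. Qed.

Lemma dual_fun_inj (V : normedModType K) (f g : dual V) :
  dual_fun f =1 dual_fun g -> f = g.
Proof. by move=> fg; apply/val_inj/funext. Qed.

Lemma dual_funB (V : normedModType K) (f : dual V) u v :
  dual_fun f (u - v) = dual_fun f u - dual_fun f v.
Proof.
have := dual_linear f (-1) v u; rewrite scaleN1r mulN1r addrC => ->.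
by rewrite addrC.
Qed.

Lemma dual_norm_le1 (V : normedModType K) (f : dual V) v :
  rnorm f <= 1 -> rnorm (dual_fun f v) <= rnorm v.
Proof.
move=> f1; rewrite (le_trans (dual_rnormP f v))// ler_piMl ?rnorm_ge0//.
by rewrite -rnorm_dual.
Qed.

Lemma dual_fun_linearP (V : normedModType K) (a : K) (f g : dual V) v :
  dual_fun (a *: f + g) v = a * dual_fun f v + dual_fun g v.
Proof. by rewrite /dual_fun linearP. Qed.

Section QuotientAdjoint.
Variables (W : normedModType K) (L : closed_subspace W).

Lemma quot_map_linear (a : K) (u v : W) :
  quot_map L (a *: u + v) = a *: quot_map L u + quot_map L v.
Proof. by rewrite quot_mapD quot_mapZ. Qed.

Lemma quot_mapB (u v : W) : quot_map L (u - v) = quot_map L u - quot_map L v.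
Proof. by rewrite -scaleN1r addrC quot_map_linear scaleN1r addrC. Qed.

Lemma quot_adjoint_subproof (f : dual (quot_space L)) :
  exists d : dual W, dual_fun d = dual_fun f \o quot_map L.
Proof.
have [||w|d df _] := @dual_of_bounded W (dual_fun f \o quot_map L) (rnorm f).
- by move=> a u v /=; rewrite quot_map_linear dual_linear.
- exact: rnorm_ge0.
- rewrite /= (le_trans (dual_rnormP f _))// rnorm_dual ler_wpM2l ?dual_rnorm_ge0//.
  by rewrite rnorm_quot quot_rnorm_le.
- by exists d.
Qed.

Definition quot_adjoint (f : dual (quot_space L)) : dual W :=
  sval (cid (quot_adjoint_subproof f)).

Lemma quot_adjointE f w : dual_fun (quot_adjoint f) w = dual_fun f (quot_map L w).
Proof. by rewrite /quot_adjoint; case: cid => d /= ->. Qed.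

Lemma quot_adjoint_linear (a : K) f g :
  quot_adjoint (a *: f + g) = a *: quot_adjoint f + quot_adjoint g.
Proof.
by apply: dual_fun_inj => w; rewrite dual_fun_linearP !quot_adjointE dual_fun_linearP.
Qed.

(** The adjoint is a contraction because the quotient map is one; conversely, every class of norm at
    most 1 has representatives of norm arbitrarily close to at most 1. *)
Lemma quot_adjoint_isometry f : rnorm (quot_adjoint f) = rnorm f.
Proof.
rewrite !rnorm_dual; apply/eqP; rewrite eq_le; apply/andP; split.
  apply: dual_rnorm_le => w w1; rewrite quot_adjointE.
  rewrite (le_trans (dual_rnormP f _))// ler_piMr ?dual_rnorm_ge0//.
  by rewrite rnorm_quot (le_trans (quot_rnorm_le _ _)).
apply: dual_rnorm_le => v v1; apply/ler_addgt0Pl => e e0.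
(* A representative is taken within [e / (N + 1)] of the quotient norm, so that the total error
   [N * e / (N + 1)] is at most [e], also when [N] is 0. *)
set N := dual_rnorm (quot_adjoint f).
have N1 : 0 < N + 1 by rewrite ltr_wpDl// dual_rnorm_ge0.
have [w wv wlt] := quot_rnorm_lt v (divr_gt0 e0 N1).
rewrite -wv -quot_adjointE (le_trans (dual_rnormP _ _))// -/N.
have {}wlt : rnorm w <= 1 + e / (N + 1).
  by rewrite (le_trans (ltW wlt))// lerD2r -rnorm_quot.
rewrite (le_trans (ler_wpM2l (dual_rnorm_ge0 _) wlt))// -/N mulrDr mulr1 addrC.
by rewrite lerD2r mulrCA ger_pMr// ler_pdivrMr// mul1r lerDl.
Qed.

(** A functional vanishing on [L] is constant on classes, hence can be evaluated at [repr]. Its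
    bound holds at every representative and so passes to the infimum defining the quotient norm. *)
Lemma quot_adjoint_lift (y : dual W) :
  (forall w, subspace_set L w -> dual_fun y w = 0) -> exists f, quot_adjoint f = y.
Proof.
move=> yL.
have yq u v : quot_map L u = quot_map L v -> dual_fun y u = dual_fun y v.
  by move=> /quot_mapP /yL; rewrite dual_funB => /eqP; rewrite subr_eq0 => /eqP.
have yr w : dual_fun y (repr (quot_map L w)) = dual_fun y w.
  by apply: yq; rewrite /quot_map reprK.
have [||v|f fy _] := @dual_of_bounded (quot_space L)
    (fun q => dual_fun y (repr q)) (rnorm y).
- move=> a u v; have [u' <-] := quot_map_surj u; have [v' <-] := quot_map_surj v.
  by rewrite -quot_map_linear !yr dual_linear.
- exact: rnorm_ge0.
- rewrite rnorm_dual rnorm_quot.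
  have [y0|y0] := eqVneq (dual_rnorm y) 0.
    by rewrite (le_trans (dual_rnormP y _))// y0 !mul0r.
  have {}y0 : 0 < dual_rnorm y by rewrite lt_neqAle eq_sym y0 dual_rnorm_ge0.
  rewrite -ler_pdivrMl//; apply: lb_le_inf; first by case: (quot_rnorm_has_inf v).
  by move=> _ [w /= <- <-]; rewrite ler_pdivrMl// yr dual_rnormP.
- by exists f; apply: dual_fun_inj => w; rewrite quot_adjointE fy yr.
Qed.

(** Both suprema run over the same set of values: a functional on the dual of [W] is composed with
    the adjoint, and one on the dual of the quotient is extended along this isometry by
    Hahn-Banach. *)
Lemma weak_norm_quot_adjoint (q : \bar R) m (y : 'I_m -> dual (quot_space L)) :
  weak_norm q (fun j => quot_adjoint (y j)) = weak_norm q y.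
Proof.
congr ereal_sup; apply/seteqP; split=> _ [psi /= psi1 <-].
- have [|f|d dpsi d1] :=
      @dual_of_bounded _ (dual_fun psi \o quot_adjoint) 1 _ ler01.
  + by move=> a u v /=; rewrite quot_adjoint_linear dual_linear.
  + by rewrite /= mul1r -quot_adjoint_isometry dual_norm_le1.
  + by exists d => //; rewrite dpsi.
- have [||||f|g [glin gle gpsi]] := @hahn_banach R k _ _ quot_adjoint
      (fun d => rnorm d) (dual_fun psi).
  + exact: ler_rnormD.
  + exact: rnormZ.
  + exact: quot_adjoint_linear.
  + exact: dual_linear.
  + by rewrite quot_adjoint_isometry dual_norm_le1.
  have [|v|d dg d1] := @dual_of_bounded _ g 1 glin; first exact: ler01.
    by rewrite mul1r.
  exists d => //; congr (_%:E); congr lp_norm; apply/funext => j.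
  by rewrite dg gpsi.
Qed.

End QuotientAdjoint.

End Functionals.

(** * Forms on tensor products *)

Section Forms.
Variables (R : realType) (k : scalar_kind).
Local Notation K := (scalars R k).
Variable n : nat.

Lemma linearization_linear (V : 'I_n -> normedModType K) (phi : mform V)
    (a : K) (u v : tensor V) :
  linearization phi (a *: u + v) = a * linearization phi u + linearization phi v.
Proof. by rewrite /linearization linearP. Qed.

Lemma tens_multilinear (V : 'I_n -> normedModType K) : multilinear (@tens R k n V).
Proof.
move=> x i a u v; apply: val_inj; rewrite linearP; apply/funext => phi.
exact: formP.
Qed.

Lemma tensor_span (V : 'I_n -> normedModType K) (u : tensor V) :
  exists s : seq (K * forall i, V i), u = \sum_(t <- s) t.1 *: tens t.2.
Proof.
have /asboolP[s us] := valP u; exists s; apply: val_inj.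
by rewrite us raddf_sum; apply: eq_bigr => t _.
Qed.

(** This follows from [0 = beta (u - u) <= beta u + beta (- u) = 2 beta u]. *)
Lemma norm_ge0 (V : 'I_n -> normedModType K) (beta : tensor V -> R) u :
  is_norm beta -> 0 <= beta u.
Proof.
case=> bD bZ _; have := bD u (- u).
have := bZ 0 0; rewrite scaler0 rnorm0 mul0r subrr => ->.
by rewrite -scaleN1r bZ rnormN rnorm1 mul1r; lra.
Qed.

(** Turns the supremum over the unit ball into the pointwise bound that Hahn-Banach takes and
    returns. Nonnegativity and homogeneity pass directly to [restr_norm beta], whereas definiteness
    would first call for injectivity of [tensor_incl]. *)
Lemma form_norm_le1P (V : 'I_n -> normedModType K) (beta : tensor V -> R) phi :
  (forall u, 0 <= beta u) -> (forall (a : K) u, beta (a *: u) = rnorm a * beta u) ->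
  (form_norm beta phi <= 1)%E <->
  forall u, rnorm (linearization phi u) <= beta u.
Proof.
move=> b0 bZ; split=> [phi1 u|phib]; last first.
  apply: ge_ereal_sup => _ [u /= u1 <-].
  by rewrite lee_fin (le_trans (phib u)).
rewrite leNgt; apply/negP; set l := rnorm _; set b := beta u => bl.
have bl0 : 0 < b + l by rewrite ltr_wpDl ?(le_lt_trans _ bl)// b0.
(* If [b < l], this factor gives [t * b < 1 < t * l]; unlike [1 / b] it also works when [b] is 0. *)
pose t := 2 / (b + l); have t0 : 0 < t by rewrite divr_gt0.
suff : t * l <= 1 by rewrite /t mulrAC ler_pdivrMr // mul1r; lra.
have -> : t * l = rnorm (linearization phi (ofR k t *: u)).
  rewrite -[ofR k t *: u]addr0 linearization_linear.
  by rewrite [linearization _ 0]/linearization raddf0 addr0 rnormM rnorm_ofR// ltW.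
rewrite -lee_fin (le_trans _ phi1)//; apply: ereal_sup_ubound.
exists (ofR k t *: u) => //=; rewrite bZ (rnorm_ofR k (ltW t0)) -/b.
by rewrite /t mulrAC ler_pdivrMr // mul1r; lra.
Qed.

Section Restriction.
Variables (V : 'I_n -> normedModType K) (E : forall i, lin_subspace (V i)).
Local Notation VE := (fun i => subspace_type (E i) : normedModType K).
Variables (beta : tensor V -> R) (bnorm : is_norm beta).

Lemma tensor_incl_linear (a : K) (u v : tensor VE) :
  tensor_incl (a *: u + v) = a *: tensor_incl u + tensor_incl v.
Proof.
apply: val_inj; rewrite linearP; apply/funext => phi.
exact: linearization_linear.
Qed.

Lemma linearization_form_restr (phi : mform V) (u : tensor VE) :
  linearization (form_restr E phi) u = linearization phi (tensor_incl u).
Proof. by []. Qed.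

Lemma restr_normZ (a : K) (u : tensor VE) :
  restr_norm beta (a *: u) = rnorm a * restr_norm beta u.
Proof.
have i0 : tensor_incl (0 : tensor VE) = 0.
  have := tensor_incl_linear (-1) 0 0.
  by rewrite scaler0 addr0 scaleN1r addNr.
rewrite /restr_norm -[a *: u]addr0 tensor_incl_linear i0 addr0.
by case: bnorm.
Qed.

Lemma form_norm_restr_le1P (phi : mform VE) :
  (form_norm (restr_norm beta) phi <= 1)%E <->
  forall u, rnorm (linearization phi u) <= beta (tensor_incl u).
Proof.
apply: form_norm_le1P; last exact: restr_normZ.
by move=> u; exact: norm_ge0 bnorm.
Qed.

(** Hahn-Banach is applied to the linearization of [phi] along [tensor_incl], with [beta] as the
    sublinear bound; composing the extension with [tens] gives a multilinear form again. *)
Lemma form_extension (phi : mform VE) : (form_norm (restr_norm beta) phi <= 1)%E ->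
  exists2 Phi : mform V, (form_norm beta Phi <= 1)%E &
    forall x : forall i, VE i, Phi (subspace_incl x) = phi x.
Proof.
move=> /form_norm_restr_le1P phib; have [bD bZ _] := bnorm.
have [g [glin gb gphi]] := hahn_banach bD bZ tensor_incl_linear
  (linearization_linear phi) phib.
have gm : multilinear ((g \o @tens R k n V) : (forall i, V i) -> K^o).
  by move=> x i a u v; rewrite /= tens_multilinear glin.
have g0 : g 0 = 0 by have := glin (-1) 0 0; rewrite scaler0 addr0 mulN1r addNr.
exists (MForm gm); last by move=> x; rewrite /= -tensor_incl_tens gphi.
apply/form_norm_le1P => // u; first exact: norm_ge0 bnorm.
(* Both sides are linear and agree on decomposable tensors, which span. *)
suff -> : linearization (MForm gm) u = g u by exact: gb.
have [s ->] := tensor_span u; elim: s => [|t s IH].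
  by rewrite big_nil g0 /linearization raddf0.
by rewrite big_cons linearization_linear glin IH.
Qed.

(** The two suprema have the same set of values: forms pass to the subspaces by [form_restr] and
    back by [form_extension], staying in the unit balls. *)
Lemma weak_beta_norm_restr (p : \bar R) m (x z : 'I_m -> forall i, VE i) :
  weak_beta_norm p (restr_norm beta) x z =
  weak_beta_norm p beta (fun j => subspace_incl (x j)) (fun j => subspace_incl (z j)).
Proof.
congr ereal_sup; apply/seteqP; split=> _ [phi /= phi1 <-].
- have [Phi Phi1 Phie] := form_extension phi1; exists Phi => //.
  by congr (_%:E); congr lp_norm; apply/funext => j; rewrite !Phie.
- exists (form_restr E phi) => //=; apply/form_norm_restr_le1P => u.
  rewrite linearization_form_restr; move: (tensor_incl u); case: bnorm => bD bZ _.
  by apply/form_norm_le1P => // u'; exact: norm_ge0 bnorm.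
Qed.

End Restriction.

End Forms.

(** * Finite-dimensional data *)

Section FiniteDimension.
Variables (R : realType) (k : scalar_kind).
Local Notation K := (scalars R k).

Lemma finite_dimensional_span (V : lmodType K) m (b : nat -> V) :
  (forall v, exists c : nat -> K, v = \sum_(i < m) c i *: b i) ->
  finite_dimensional V.
Proof.
move=> bV; exists (mkseq b m) => v; have [c ->] := bV v; exists c.
rewrite size_mkseq; apply: eq_bigr => i _.
by rewrite nth_mkseq.
Qed.

Lemma span_subspace (V : normedModType K) (s : seq V) :
  exists2 E : lin_subspace V, finite_dimensional (subspace_type E) &
    forall v, v \in s -> subspace_set E v.
Proof.
pose S := [set v | exists c : nat -> K, v = \sum_(i < size s) c i *: s`_i].
have S0 : S 0 by exists (fun=> 0); rewrite big1// => i _; rewrite scale0r.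
have SP (a : K) u v : S u -> S v -> S (a *: u + v).
  move=> [c ->] [d ->]; exists (fun i => a * c i + d i).
  rewrite scaler_sumr -big_split; apply: eq_bigr => i _ /=.
  by rewrite scalerDl scalerA.
have Ss i : S s`_i.
  (* Beyond the length of the list [nth] returns the default 0, which lies in [S] as well. *)
  have [si|si] := ltnP i (size s); last by rewrite nth_default.
  exists (fun j => (j == i)%:R); rewrite (bigD1 (Ordinal si))//= eqxx scale1r.
  rewrite big1 ?addr0// => j; rewrite -val_eqE /= => /negPf ->.
  by rewrite scale0r.
pose E := Subspace S0 SP; exists E; last first.
  by move=> v /(nthP 0)[i _ <-]; exact: Ss.
have Es i : s`_i \in in_subspace E by apply/asboolP; exact: Ss.
apply: (@finite_dimensional_span _ (size s)
  (fun i => exist (fun v => v \in in_subspace E) s`_i (Es i) : subspace_type E)).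
move=> v; have /asboolP[c vc] := valP v; exists c; apply: val_inj.
by rewrite vc raddf_sum; apply: eq_bigr => i _.
Qed.

(** Induction on the list: one more functional [y] raises the codimension of the common kernel by at
    most one. Either [y] is nonzero at some [w] of the old kernel, and [w] joins the spanning
    family, or [y] already vanishes there. *)
Lemma annihilator_codim (W : normedModType K) (ys : seq (dual W)) :
  exists m (b : nat -> W), forall v, exists c : nat -> K,
    forall f, f \in ys -> dual_fun f (v - \sum_(i < m) c i *: b i) = 0.
Proof.
elim: ys => [|y ys [m [b bP]]].
  by exists 0%N, (fun=> 0) => v; exists (fun=> 0).
have [[w [wys yw]]|noW] := pselect (exists w,
    (forall f, f \in ys -> dual_fun f w = 0) /\ dual_fun y w <> 0).
- exists m.+1, (fun i => if i is j.+1 then b j else w) => v.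
  have [c cP] := bP v.
  (* The coefficient [a] is chosen so that [y] vanishes at [r - a *: w]; the older functionals
     vanish at both [r] and [w]. *)
  pose r := v - \sum_(i < m) c i *: b i; pose a := dual_fun y r / dual_fun y w.
  exists (fun i => if i is j.+1 then c j else a) => f.
  rewrite big_ord_recl /= opprD addrCA addrC -/r -scaleNr addrC.
  rewrite dual_linear inE => /orP[/eqP ->|fys].
    by rewrite mulNr mulfVK ?subrr ?addNr//; apply/eqP.
  by rewrite wys// mulr0 add0r cP.
- exists m, b => v; have [c cP] := bP v; exists c => f.
  rewrite inE => /orP[/eqP ->|]; last exact: cP.
  by apply: contrapT => yr; apply: noW; eexists; split; [exact: cP|exact: yr].
Qed.

(** The common kernel is closed as an intersection of preimages of 0 under continuous maps, and the
    classes of the vectors from [annihilator_codim] span the quotient. *)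
Lemma annihilator_subspace (W : normedModType K) (ys : seq (dual W)) :
  exists2 L : closed_subspace W, finite_dimensional (quot_space L) &
    forall y, y \in ys -> forall w, subspace_set L w -> dual_fun y w = 0.
Proof.
pose S := [set w : W | forall y, y \in ys -> dual_fun y w = 0].
have S0 : S 0.
  by move=> y _; have := dual_funB y 0 0; rewrite !subrr.
have SP (a : K) u v : S u -> S v -> S (a *: u + v).
  by move=> Su Sv y yys; rewrite dual_linear Su// Sv// mulr0 addr0.
have Sclosed : closed (Subspace S0 SP).
  rewrite [X in closed X]/=.
  have -> : S = \bigcap_(y in [set` ys]) [set w | dual_fun y w = 0].
    by apply/seteqP; split.
  apply: closed_bigI => y _.
  apply: (@closed_comp _ _ (dual_fun y : W -> K^o) [set 0]).
    by move=> w _; exact: dual_continuous.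
  exact: accessible_closed_set1 (hausdorff_accessible (@norm_hausdorff K _)) _.
exists (ClosedSubspace Sclosed); last by move=> y yys w; apply.
have [m [b bP]] := annihilator_codim ys.
apply: (@finite_dimensional_span _ m (fun i => quot_map _ (b i))) => q.
have [v <-] := quot_map_surj q; have [c cP] := bP v; exists c.
transitivity (quot_map (ClosedSubspace Sclosed) (\sum_(i < m) c i *: b i)).
  exact/quot_mapP.
apply: (big_ind2 (fun u q => quot_map _ u = q)) => [|u _ u' _ <- <-|i _].
- by have := quot_mapB (ClosedSubspace Sclosed) 0 0; rewrite !subrr.
- exact: quot_mapD.
- exact: quot_mapZ.
Qed.

End FiniteDimension.

(** * Domination *)

Section Domination.
Variables (R : realType) (k : scalar_kind).
Local Notation K := (scalars R k).

Lemma lp_norm_ge0 (p : \bar R) m (a : 'I_m -> K) : 0 <= lp_norm p a.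
Proof.
case: p => [p| |] //=; first exact: powR_ge0.
by elim/big_ind : _ => // [u v u0 v0|i _]; rewrite ?rnorm_ge0// le_max u0.
Qed.

Lemma weak_norm_ge0 (q : \bar R) (W : normedModType K) m (y : 'I_m -> dual W) :
  (0 <= weak_norm q y)%E.
Proof.
apply: (@le_trans _ _ (lp_norm q (fun j => dual_fun 0 (y j)))%:E).
  by rewrite lee_fin lp_norm_ge0.
by apply: ereal_sup_ubound; exists 0 => //=; rewrite rnorm0.
Qed.

Variable n : nat.

Section DominationMonotone.
Variables (V : 'I_n -> normedModType K) (W : normedModType K).
Variables (p q : \bar R) (beta : tensor V -> R) (T : (forall i, V i) -> W).

(** The zero form lies in the unit ball, so the supremum is over a nonempty set of nonnegative
    numbers. *)
Lemma weak_beta_norm_ge0 m (x z : 'I_m -> forall i, V i) :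
  (forall u, 0 <= beta u) -> (0 <= weak_beta_norm p beta x z)%E.
Proof.
move=> b0.
have zm : multilinear ((fun=> 0) : (forall i, V i) -> K^o).
  by move=> *; rewrite scaler0 addr0.
apply: (@le_trans _ _ (lp_norm p (fun j => MForm zm (x j) - MForm zm (z j)))%:E).
  by rewrite lee_fin lp_norm_ge0.
apply: ereal_sup_ubound; exists (MForm zm) => //=.
apply: ge_ereal_sup => _ [u _ <-]; rewrite lee_fin.
have [s ->] := tensor_span u.
suff -> : linearization (MForm zm) (\sum_(t <- s) t.1 *: tens t.2) = 0.
  by rewrite rnorm0 ler01.
elim: s => [|t s IH]; first by rewrite big_nil /linearization raddf0.
by rewrite big_cons linearization_linear IH addr0 mulr0.
Qed.

Lemma dominated_with_le (C D : R) : (forall u, 0 <= beta u) -> C <= D ->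
  dominated_with p q beta T C -> dominated_with p q beta T D.
Proof.
move=> b0 CD TC m x z y; apply: le_trans (TC m x z y) _.
by rewrite lee_wpmul2r ?weak_norm_ge0// lee_wpmul2r ?weak_beta_norm_ge0// lee_fin.
Qed.

Lemma dominated_norm_ge0 : (0 <= dominated_norm p q beta T)%E.
Proof. by apply: le_ereal_inf_tmp => _ [C [C0 _] <-]; rewrite lee_fin ltW. Qed.

(** Strictness yields an admissible constant below [C], which monotonicity raises to [C]. *)
Lemma dominated_norm_lt (C : R) : (forall u, 0 <= beta u) ->
  (dominated_norm p q beta T < C%:E)%E -> dominated_with p q beta T C.
Proof.
move=> b0 /ereal_inf_lt[_ [D [_ TD] <-]]; rewrite lte_fin => /ltW DC.
exact: dominated_with_le TD.
Qed.

End DominationMonotone.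

Variables (V : 'I_n -> normedModType K) (W : normedModType K).
Variables (p q : \bar R) (beta : tensor V -> R) (bnorm : is_norm beta).
Variable T : (forall i, V i) -> W.

(* By Hahn-Banach the weak norms computed in E, Y/L and in X, Y agree. *)
Lemma dominated_with_reductionE (E : forall i, lin_subspace (V i))
    (L : closed_subspace W) (C : R) :
  dominated_with p q (restr_norm (E := E) beta) (reduction T L) C <->
  forall m (x z : 'I_m -> forall i, subspace_type (E i))
    (y : 'I_m -> dual (quot_space L)),
    ((lp_norm (hoelder_conjugate (third_exponent p q))
        (fun j => dual_fun (quot_adjoint (y j))
          (T (subspace_incl (x j)) - T (subspace_incl (z j)))))%:E
     <= C%:E * weak_beta_norm p beta (fun j => subspace_incl (x j))
                                     (fun j => subspace_incl (z j))
        * weak_norm q (fun j => quot_adjoint (y j)))%E.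
Proof.
have lpE m (x z : 'I_m -> forall i, subspace_type (E i))
    (y : 'I_m -> dual (quot_space L)) :
    (fun j => dual_fun (y j) (reduction T L (x j) - reduction T L (z j))) =
    (fun j => dual_fun (quot_adjoint (y j))
      (T (subspace_incl (x j)) - T (subspace_incl (z j)))).
  by apply/funext => j; rewrite quot_adjointE quot_mapB.
split=> TC m x z y; have := TC m x z y.
- by rewrite lpE (weak_beta_norm_restr bnorm) weak_norm_quot_adjoint.
- by rewrite -lpE -(weak_beta_norm_restr bnorm) weak_norm_quot_adjoint.
Qed.

(** Domination of the reduction is the inequality for [T] tested only on points of the subspaces and
    functionals in the range of the adjoint, so the constant is kept. *)
Lemma dominated_with_reduction (E : forall i, lin_subspace (V i))
    (L : closed_subspace W) (C : R) :
  dominated_with p q beta T C ->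
  dominated_with p q (restr_norm (E := E) beta) (reduction T L) C.
Proof. by move=> TC; apply/dominated_with_reductionE => m x z y; exact: TC. Qed.

(** The lifts are stated as equalities of whole families, so that they can be rewritten inside the
    weak norms. *)
Lemma finite_data_reduction m (x z : 'I_m -> forall i, V i) (y : 'I_m -> dual W) :
  exists (E : forall i, lin_subspace (V i)) (L : closed_subspace W),
    [/\ forall i, finite_dimensional (subspace_type (E i)),
        finite_dimensional (quot_space L) &
        exists (x' z' : 'I_m -> forall i, subspace_type (E i))
               (y' : 'I_m -> dual (quot_space L)),
          [/\ (fun j => subspace_incl (x' j)) = x,
              (fun j => subspace_incl (z' j)) = z &
              (fun j => quot_adjoint (y' j)) = y]].
Proof.
have Eex i : exists E : lin_subspace (V i), finite_dimensional (subspace_type E) /\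
    forall j, x j i \in in_subspace E /\ z j i \in in_subspace E.
  have [E Efin Es] := span_subspace ([seq x j i | j <- enum 'I_m] ++
                                     [seq z j i | j <- enum 'I_m]).
  exists E; split=> // j; split; apply/asboolP/Es; rewrite mem_cat; apply/orP.
    by left; apply/mapP; exists j => //; rewrite mem_enum.
  by right; apply/mapP; exists j => //; rewrite mem_enum.
pose E i := sval (cid (Eex i)).
have EP i := svalP (cid (Eex i)).
have [L Lfin LP] := annihilator_subspace [seq y j | j <- enum 'I_m].
have yex j : exists f : dual (quot_space L), quot_adjoint f = y j.
  by apply/quot_adjoint_lift/LP/mapP; exists j => //; rewrite mem_enum.
exists E, L; split=> //; first by move=> i; case: (EP i).
exists (fun j i => exist (fun v => v \in in_subspace (E i)) (x j i) ((EP i).2 j).1),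
  (fun j i => exist (fun v => v \in in_subspace (E i)) (z j i) ((EP i).2 j).2),
  (fun j => sval (cid (yex j))).
by split=> //; apply/funext => j; exact: (svalP (cid (yex j))).
Qed.

(** The subspaces vary with the data, hence the need for one constant [C] valid for all of them. *)
Lemma dominated_with_of_reductions (C : R) :
  (forall (E : forall i, lin_subspace (V i)) (L : closed_subspace W),
     (forall i, finite_dimensional (subspace_type (E i))) ->
     finite_dimensional (quot_space L) ->
     dominated_with p q (restr_norm (E := E) beta) (reduction T L) C) ->
  dominated_with p q beta T C.
Proof.
move=> redC m x z y.
have [E [L [Efin Lfin [x' [z' [y' [<- <- <-]]]]]]] := finite_data_reduction x z y.
by have /dominated_with_reductionE := redC E L Efin Lfin; apply.
Qed.

End Domination.

Theorem theorem4p4 (R : realType) (k : scalar_kind) (p q : \bar R)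
    (hp : (1 <= p)%E) (hq : (1 <= q)%E) (hpq : (p^-1 + q^-1 <= 1)%E)
    (n : nat) (hn : (0 < n)%N)
    (X : 'I_n -> completeNormedModType (scalars R k))
    (Y : completeNormedModType (scalars R k))
    (beta : tensor (fun i => X i : normedModType (scalars R k)) -> R)
    (hbeta : reasonable_crossnorm beta)
    (T : (forall i, X i) -> Y)
    (hT : @multilinear R k n (fun i => X i) Y T) :
  (dominated p q beta T <->
   exists2 C : R, 0 < C &
     forall (E : forall i, lin_subspace (X i)) (L : closed_subspace Y),
       (forall i, finite_dimensional (subspace_type (E i))) ->
       finite_dimensional (quot_space L) ->
       dominated p q (restr_norm (E := E) beta) (reduction T L) /\
       (dominated_norm p q (restr_norm (E := E) beta) (reduction T L) <= C%:E)%E)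
  /\
  (dominated p q beta T ->
   dominated_norm p q beta T =
   ereal_sup [set d | exists (E : forall i, lin_subspace (X i)) (L : closed_subspace Y),
     [/\ forall i, finite_dimensional (subspace_type (E i)),
         finite_dimensional (quot_space L) &
         d = dominated_norm p q (restr_norm (E := E) beta) (reduction T L)]]).
Proof.
have [bnorm _] := hbeta.
have b0 (E : forall i, lin_subspace (X i)) u : 0 <= restr_norm (E := E) beta u.
  exact: norm_ge0 bnorm.
split; [split|].
- move=> [C C0 TC]; exists C => // E L _ _.
  have redC : dominated_with p q (restr_norm (E := E) beta) (reduction T L) C.
    exact: dominated_with_reduction.
  by split; [exists C|apply: ereal_inf_lbound; exists C].
(* The bound by [C] concerns an infimum; any constant strictly above [C], here [C + 1], is then
   admissible for every reduction at once. *)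
- move=> [C C0 redC]; exists (C + 1); first by rewrite addr_gt0.
  apply: (dominated_with_of_reductions bnorm) => E L Efin Lfin.
  have [_ leC] := redC E L Efin Lfin; apply: dominated_norm_lt => //.
  by rewrite (le_lt_trans leC)// lte_fin ltrDl.
- move=> _; set S := ereal_sup _.
  have redS (E : forall i, lin_subspace (X i)) (L : closed_subspace Y) :
      (forall i, finite_dimensional (subspace_type (E i))) ->
      finite_dimensional (quot_space L) ->
      (dominated_norm p q (restr_norm (E := E) beta) (reduction T L) <= S)%E.
    by move=> Efin Lfin; apply: ereal_sup_ubound; exists E, L.
  apply/eqP; rewrite eq_le; apply/andP; split.
    apply/lee_addgt0Pr => e e0.
    (* Empty data, with [m = 0], already provide one admissible choice of subspaces, so [S] is not
       the supremum of the empty set. This excludes [-oo] and makes [s + e] positive below. *)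
    have S0 : (0 <= S)%E.
      have noarg (A : Type) : 'I_0 -> A by case.
      have [E [L [Efin Lfin _]]] :=
        @finite_data_reduction R k n (fun i => X i) Y 0 (noarg _) (noarg _) (noarg _).
      exact: le_trans (dominated_norm_ge0 _ _ _ _) (redS E L Efin Lfin).
    case: S S0 redS => [s| |] // s0 redS; last by rewrite leey.
    apply: ereal_inf_lbound; exists (s + e); rewrite ?EFinD//; split.
      by rewrite ltr_wpDl.
    apply: (dominated_with_of_reductions bnorm) => E L Efin Lfin.
    apply: dominated_norm_lt => //.
    by rewrite (le_lt_trans (redS E L Efin Lfin))// lte_fin ltrDl.
  (* For the reverse inequality, each constant admissible for [T] is admissible for every reduction,
     so the infimum for the reduction is the smaller one. *)
  apply: ge_ereal_sup => _ [E [L [_ _ ->]]].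
  apply: ereal_inf_le_tmp => _ [C [C0 TC] <-]; exists C; split=> //.
  exact: dominated_with_reduction.
Qed.
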